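(* Let $\mathbb{M}$ be any one of the following classes of neighborhood models: the class of all models, the class of $(m)$-models, the class of $(c)$-models, the class of $(n)$-models, the class of $(r)$-models. Then on $\mathbb{M}$ the languages $\mathcal{L}(\bullet)$ and $\mathcal{L}(W)$ are incomparable in expressivity, and thus both $\mathcal{L}(\bullet)$ and $\mathcal{L}(W)$ are less expressive than $\mathcal{L}(\bullet,W)$ on $\mathbb{M}$.
   Context: Fix a nonempty set $\mathbf{P}$ of propositional variables, $p\in\mathbf{P}$. The languages are given by $\mathcal{L}(\bullet)$: $\varphi::=p\mid\neg\varphi\mid\varphi\land\varphi\mid\bullet\varphi$; $\mathcal{L}(W)$: $\varphi::=p\mid\neg\varphi\mid\varphi\land\varphi\mid W\varphi$; $\mathcal{L}(\bullet,W)$: $\varphi::=p\mid\neg\varphi\mid\varphi\land\varphi\mid\bullet\varphi\mid W\varphi$. A (neighborhood) model is $\mathcal{M}=\langle S,N,V\rangle$ with $S$ a nonempty set, $N:S\to\mathcal{P}(\mathcal{P}(S))$, and $V:\mathbf{P}\to\mathcal{P}(S)$. With $\varphi^{\mathcal{M}}=\{s\in S\mid\mathcal{M},s\vDash\varphi\}$, the semantics is: $\mathcal{M},s\vDash p$ iff $s\in V(p)$; Boolean connectives as usual; $\mathcal{M},s\vDash\bullet\varphi$ iff $s\in\varphi^{\mathcal{M}}$ and $\varphi^{\mathcal{M}}\notin N(s)$; $\mathcal{M},s\vDash W\varphi$ iff $\varphi^{\mathcal{M}}\in N(s)$ and $s\notin\varphi^{\mathcal{M}}$. Properties (required for all $s\in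 S$): $(m)$: $X\in N(s)$ and $X\subseteq Y\subseteq S$ imply $Y\in N(s)$; $(c)$: $X,Y\in N(s)$ imply $X\cap Y\in N(s)$; $(n)$: $S\in N(s)$; $(r)$: $\bigcap N(s)\in N(s)$. A model with property $(x)$ is called an $(x)$-model. For languages $\mathcal{L}_1,\mathcal{L}_2$ interpreted on a class $\mathbb{M}$ of models, $\mathcal{L}_1\preceq\mathcal{L}_2$ ($\mathcal{L}_2$ is at least as expressive as $\mathcal{L}_1$) if for each $\varphi\in\mathcal{L}_1$ there is $\psi\in\mathcal{L}_2$ such that for every $\mathcal{M}\in\mathbb{M}$ and every state $s$ of $\mathcal{M}$: $\mathcal{M},s\vDash\varphi$ iff $\mathcal{M},s\vDash\psi$. $\mathcal{L}_1$ is less expressive than $\mathcal{L}_2$ if $\mathcal{L}_1\preceq\mathcal{L}_2$ and $\mathcal{L}_2\not\preceq\mathcal{L}_1$. They are incomparable if $\mathcal{L}_1\not\preceq\mathcal{L}_2$ and $\mathcal{L}_2\not\preceq\mathcal{L}_1$. *)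

(* Defs.v *)
From mathcomp Require Import all_boot.
From mathcomp Require Import boolp classical_sets.

Set Implicit Arguments.
Unset Strict Implicit.
Unset Printing Implicit Defensive.

Local Open Scope classical_set_scope.

(* L(bullet, W); the two other languages are sublanguages of it, given below
   by their grammars, so that all three share one satisfaction relation. *)
Inductive form (P : Type) : Type :=
| Var of P
| Neg of form P
| And of form P & form P
| Bullet of form P
| W of form P.

Definition language (P : Type) := set (form P).

Inductive L_bullet (P : Type) : form P -> Prop :=
| L_bullet_var p : L_bullet (Var p)
| L_bullet_neg f : L_bullet f -> L_bullet (Neg f)
| L_bullet_and f g : L_bullet f -> L_bullet g -> L_bullet (And f g)
| L_bullet_bullet f : L_bullet f -> L_bullet (Bullet f).

Inductive L_W (P : Type) : form P -> Prop :=
| L_W_var p : L_W (Var p)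
| L_W_neg f : L_W f -> L_W (Neg f)
| L_W_and f g : L_W f -> L_W g -> L_W (And f g)
| L_W_W f : L_W f -> L_W (W f).

Definition L_bullet_W (P : Type) : language P := setT.

Record model (P : Type) := Model {
  state : Type;
  state_inhabited : inhabited state;
  nbh : state -> set (set state);
  valuation : P -> set state
}.

Fixpoint sat (P : Type) (M : model P) (s : state M) (f : form P) : Prop :=
  match f with
  | Var p => valuation p s
  | Neg g => ~ sat s g
  | And g h => sat s g /\ sat s h
  | Bullet g =>
      let X := [set t : state M | sat t g] in X s /\ ~ nbh s X
  | W g =>
      let X := [set t : state M | sat t g] in nbh s X /\ ~ X s
  end.

Definition m_model (P : Type) (M : model P) : Prop :=
  forall (s : state M) (X Y : set (state M)), nbh s X -> X `<=` Y -> nbh s Y.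

Definition c_model (P : Type) (M : model P) : Prop :=
  forall (s : state M) (X Y : set (state M)),
    nbh s X -> nbh s Y -> nbh s (X `&` Y).

Definition n_model (P : Type) (M : model P) : Prop :=
  forall s : state M, nbh s setT.

(* When nbh s is empty, the intersection is the whole state space. *)
Definition r_model (P : Type) (M : model P) : Prop :=
  forall s : state M, nbh s (\bigcap_(X in nbh s) X).

Definition at_most_as_expressive (P : Type) (C : set (model P))
    (L1 L2 : language P) : Prop :=
  forall f, L1 f -> exists2 g, L2 g &
    forall M : model P, C M -> forall s : state M, sat s f <-> sat s g.

Definition less_expressive (P : Type) (C : set (model P))
    (L1 L2 : language P) : Prop :=
  at_most_as_expressive C L1 L2 /\ ~ at_most_as_expressive C L2 L1.

Definition incomparable (P : Type) (C : set (model P))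
    (L1 L2 : language P) : Prop :=
  ~ at_most_as_expressive C L1 L2 /\ ~ at_most_as_expressive C L2 L1.

(* Main.v *)
Require Import Defs.
From mathcomp Require Import all_boot.
From mathcomp Require Import boolp classical_sets.

(** The truth of [Bullet f] at [s] depends only on the neighborhoods of [s] that
    contain [s], and that of [W f] only on those that do not.  So each of the two
    languages is blind to a change of neighborhoods that the other one detects.
    The changes used are between Kripke models seen as neighborhood models, which
    satisfy (m), (c), (n) and (r) at once: turning an irreflexive point into a
    reflexive one is invisible to [Bullet] but detected by [W (p /\ ~ p)], and
    adding a second successor to a reflexive point is invisible to [W] but
    detected by [Bullet p]. *)

Local Open Scope classical_set_scope.

Section Invariance.
Variables (P S : Type) (i : inhabited S) (N1 N2 : S -> set (set S)).
Variable V : P -> set S.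

Let M1 := Model i N1 V.
Let M2 := Model i N2 V.

Lemma L_bullet_invariant :
  (forall (s : S) (X : set S), X s -> N1 s X <-> N2 s X) ->
  forall f, L_bullet f -> forall s : S, @sat P M1 s f <-> @sat P M2 s f.
Proof.
move=> N12 f; elim=> {f} [p|f _ IH|f g _ IHf _ IHg|f _ IH] s //=.
- by rewrite IH.
- by rewrite IHf IHg.
- have -> : [set t : S | @sat P M1 t f] = [set t : S | @sat P M2 t f].
    by apply/seteqP; split=> t /=; apply IH.
  have := N12 s [set t : S | @sat P M2 t f]; have := IH s; tauto.
Qed.

Lemma L_W_invariant :
  (forall (s : S) (X : set S), ~ X s -> N1 s X <-> N2 s X) ->
  forall f, L_W f -> forall s : S, @sat P M1 s f <-> @sat P M2 s f.
Proof.
move=> N12 f; elim=> {f} [p|f _ IH|f g _ IHf _ IHg|f _ IH] s //=.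
- by rewrite IH.
- by rewrite IHf IHg.
- have -> : [set t : S | @sat P M1 t f] = [set t : S | @sat P M2 t f].
    by apply/seteqP; split=> t /=; apply IH.
  have := N12 s [set t : S | @sat P M2 t f]; have := IH s; tauto.
Qed.

End Invariance.

Definition kripke_model {P S : Type} (i : inhabited S) (R : S -> set S)
    (V : P -> set S) : model P :=
  Model i (fun s => [set X | R s `<=` X]) V.

(** The neighborhoods of [s] form the principal filter generated by [R s]; their intersection again
    contains [R s], which gives (r). *)
Lemma kripke_model_mcnr {P S : Type} (i : inhabited S) (R : S -> set S)
    (V : P -> set S) (M := kripke_model i R V) :
  [/\ m_model M, c_model M, n_model M & r_model M].
Proof.
split=> [s X Y RX XY|s X Y RX RY|s|s] /=.
- exact: subset_trans RX XY.
- by rewrite subsetI.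
- exact: subsetT.
- by move=> t Rt X; apply.
Qed.

Lemma W_not_L_bullet {P : Type} {C : set (model P)} : inhabited P ->
  (forall (S : Type) (i : inhabited S) R V, C (@kripke_model P S i R V)) ->
  ~ at_most_as_expressive C (@L_W P) (@L_bullet P).
Proof.
move=> [p] CK H.
(* In a Kripke model, [W] of a contradiction holds at [s] exactly when [R s] is empty. *)
have Lf : L_W (W (And (Var p) (Neg (Var p)))).
  by do !constructor.
have [g Lg fg] := H _ Lf.
pose V (_ : P) := [set: unit].
pose M1 := kripke_model (inhabits tt) (fun=> set0) V.
pose M2 := kripke_model (inhabits tt) (fun=> setT) V.
have g12 : @sat P M1 tt g <-> @sat P M2 tt g.
  (* A subset of [unit] containing [tt] is everything, hence a neighborhood in both models. *)
  apply: L_bullet_invariant Lg tt => -[] X Xtt.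
  by split=> _ [].
have /g12/(fg M2 (CK _ _ _ _)) : @sat P M1 tt g.
  by apply/(fg M1 (CK _ _ _ _)); split=> /= [t []|[]].
by move=> [/(_ tt I) []].
Qed.

Lemma bullet_not_L_W {P : Type} {C : set (model P)} : inhabited P ->
  (forall (S : Type) (i : inhabited S) R V, C (@kripke_model P S i R V)) ->
  ~ at_most_as_expressive C (@L_bullet P) (@L_W P).
Proof.
move=> [p] CK H.
have Lf : L_bullet (Bullet (Var p)) by do !constructor.
have [g Lg fg] := H _ Lf.
pose V (_ : P) := [set true].
pose M1 := kripke_model (inhabits true) (fun s => [set s]) V.
pose M2 := kripke_model (inhabits true) (fun=> setT) V.
have g12 : @sat P M1 true g <-> @sat P M2 true g.
  (* Both relations are reflexive, so a set missing [s] is a neighborhood of [s] in neither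
     model. *)
  apply: L_W_invariant Lg true => s X nXs.
  by split=> /(_ s) Xs; case: nXs; apply: Xs.
have /g12/(fg M1 (CK _ _ _ _)) : @sat P M2 true g.
  by apply/(fg M2 (CK _ _ _ _)); split=> //= /(_ false I).
by move=> [_]; apply=> t /= ->.
Qed.

Lemma at_most_as_expressive_sub {P : Type} {C : set (model P)}
    {L1 L2 : language P} : L1 `<=` L2 -> at_most_as_expressive C L1 L2.
Proof. by move=> L12 f /L12 Lf; exists f. Qed.

Lemma at_most_as_expressive_subl {P : Type} {C : set (model P)}
    {L1 L1' L2 : language P} : L1' `<=` L1 ->
  at_most_as_expressive C L1 L2 -> at_most_as_expressive C L1' L2.
Proof. by move=> sub H f /sub; apply: H. Qed.

Theorem corollary3p4 (P : Type) (hP : inhabited P) (C : set (model P))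
    (hC : C = setT \/ C = @m_model P \/ C = @c_model P \/
          C = @n_model P \/ C = @r_model P) :
  incomparable C (@L_bullet P) (@L_W P) /\
  less_expressive C (@L_bullet P) (@L_bullet_W P) /\
  less_expressive C (@L_W P) (@L_bullet_W P).
Proof.
have CK (S : Type) (i : inhabited S) R V : C (@kripke_model P S i R V).
  have [] := kripke_model_mcnr i R V.
  by case: hC => [|[|[|[|]]]] ->.
have nbW := bullet_not_L_W hP CK.
have nWb := W_not_L_bullet hP CK.
split; first by split.
split; split; try exact: at_most_as_expressive_sub.
(* A translation of the full language into one sublanguage would restrict to a translation of the
   other sublanguage, against incomparability. *)
- by move=> /(at_most_as_expressive_subl (@subsetT _ (@L_W P))).
- by move=> /(at_most_as_expressive_subl (@subsetT _ (@L_bullet P))).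
Qed.
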